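(* Assume $\mathbb E[\tanh(h)]\ne0$. When $k=\Omega(\sqrt n)$, the test that rejects the null if $\phi_9\ge\tau_\delta$, for a suitably small constant $\tau_\delta>0$, where $$\phi_9:=m^{-1}k^{-2}\sum_{j=1}^m\bigg(\Big(\sum_{i=1}^n\sigma_i^{(j)}-n\mathbb E[\tanh(h)]\Big)^2-n\big(1-\mathbb E[\tanh(h)]^2\big)\bigg),$$ is asymptotically powerful given $m=\omega(1)$.
   Context: Planted random field Curie-Weiss (pRFCW) model. Let $\mu$ be a probability measure on $\mathbb R$, $h\sim\mu$, $\theta_1>0$, $[n]=\{1,\dots,n\}$, and $h_1,\dots,h_n$ i.i.d. $\sim\mu$, $\boldsymbol h=(h_1,\dots,h_n)$. For $S\subset[n]$ with $|S|=k$ define, for $\boldsymbol\sigma\in\{-1,+1\}^n$, $$\mathbb P_S(\boldsymbol\sigma\mid\boldsymbol h)\propto\exp\Big(\frac{\theta_1}{2k}\sum_{i,j\in S}\sigma_i\sigma_j+\sum_{i=1}^n h_i\sigma_i\Big),\qquad \mathbb P_0(\boldsymbol\sigma\mid\boldsymbol h)\propto\exp\Big(\sum_{i=1}^n h_i\sigma_i\Big),$$ each normalized, and $\mathbb P_S(\boldsymbol\sigma)=\mathbb E_{\boldsymbol h}[\mathbb P_S(\boldsymbol\sigma\mid\boldsymbol h)]$, $\mathbb P_0(\boldsymbol\sigma)=\mathbb E_{\boldsymbol h}[\mathbb P_0(\boldsymbol\sigma\mid\boldsymbol h)]$. One observes $m$ i.i.d. samples $\boldsymbol\sigma^{(1)},\dots,\boldsymbol\sigma^{(m)}$;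 $\mathbb P_{0,m}$, $\mathbb P_{S,m}$ are the $m$-fold products of $\mathbb P_0$, $\mathbb P_S$. Asymptotics: $k\to\infty$ with $n=n(k)\ge k$, $m=m(k)\ge1$; $\mu,\theta_1$ fixed. A sequence of tests $\psi$ ($\psi=1$ means reject the null) is asymptotically powerful if $$\lim_{k\to\infty}\Big[\mathbb P_{0,m}(\psi=1)+\sup_{S:|S|=k}\mathbb P_{S,m}(\psi=0)\Big]=0.$$ $a=\Omega(b)$ means $b=O(a)$; $a=\omega(b)$ means $b=o(a)$. *)

(* Defs.v *)
From HB Require Import structures.
From mathcomp Require Import all_boot all_order all_algebra.
From mathcomp Require Import all_classical all_reals all_analysis.
Set Implicit Arguments.
Unset Strict Implicit.
Unset Printing Implicit Defensive.
Import Order.TTheory GRing.Theory Num.Theory.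
Import numFieldNormedType.Exports.
Local Open Scope classical_set_scope.
Local Open Scope ring_scope.

Section product_law.
Context d (T : measurableType d) (R : realType) (mu : probability T R).

Definition cons_pair (n : nat) (x : T * n.-tuple T) : n.+1.-tuple T :=
  [the n.+1.-tuple T of x.1 :: x.2].

Lemma measurable_cons_pair n :
  measurable_fun [set: T * n.-tuple T] (@cons_pair n).
Proof.
apply: measurable_cons.
  exact: measurable_fst.
exact: measurable_snd.
Qed.

HB.instance Definition _ n := isMeasurableFun.Build _ _ _ _ (@cons_pair n)
  (@measurable_cons_pair n).

(* The n-fold product measure of mu on n.-tuple T, characterized by its values
   on measurable boxes (iid_lawE). *)
Fixpoint iid_law (n : nat) : probability (n.-tuple T) R :=
  if n is n'.+1 then distribution (mu \x iid_law n')%E (@cons_pair n')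
  else dirac [tuple].

Lemma measurable_box n (A : 'I_n -> set T) : (forall i, measurable (A i)) ->
  measurable [set t : n.-tuple T | forall i, A i (tnth t i)].
Proof.
move=> mA.
have -> : [set t : n.-tuple T | forall i, A i (tnth t i)] =
    \bigcap_(i in [set: 'I_n]) ((fun t : n.-tuple T => tnth t i) @^-1` A i).
  by apply/seteqP; split=> t /= h i //=; exact: h.
apply: fin_bigcap_measurable => [|i _]; first exact: finite_finset.
rewrite -[X in measurable X]setTI; by apply: (@measurable_tnth _ _ _ i) => //; exact: measurableT.
Qed.

Lemma iid_lawE n (A : 'I_n -> set T) : (forall i, measurable (A i)) ->
  iid_law n [set t | forall i, A i (tnth t i)] = (\prod_(i < n) mu (A i))%E.
Proof.
elim: n A => [|n IHn] A mA /=.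
  rewrite big_ord0 diracE mem_set//; by case.
rewrite big_ord_recl -IHn//.
have := product_measure1E mu (iid_law n) (mA ord0)
  (measurable_box (fun i => mA (lift ord0 i))).
move=> <-; rewrite /distribution /pushforward /=.
congr (_ _); apply/seteqP; split=> -[x t] /=.
  move=> h; split; first exact: (h ord0).
  by move=> i; have := h (lift ord0 i); rewrite tnthS.
move=> [h0 h] i; case: (unliftP ord0 i) => [j ->|->] //.
by rewrite tnthS.
Qed.

End product_law.

Section pRFCW.
Context (R : realType).

Definition tanh (x : R) : R := (expR x - expR (- x)) / (expR x + expR (- x)).

(* Spin configurations in {-1,+1}^n; [spin] gives the numerical value. *)
Definition config (n : nat) := {ffun 'I_n -> bool}.

Definition spin (b : bool) : R := if b then 1 else -1.

Definition gibbs (n : nat) (H : config n -> R) (s : config n) : R :=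
  expR (H s) / \sum_(t : config n) expR (H t).

Definition field_energy (n : nat) (h : n.-tuple R) (s : config n) : R :=
  \sum_(i < n) tnth h i * spin (s i).

Definition planted_energy (theta1 : R) (n : nat) (S : {set 'I_n})
    (h : n.-tuple R) (s : config n) : R :=
  theta1 / (2 * #|S|%:R) *
    (\sum_(i in S) \sum_(j in S) spin (s i) * spin (s j))
  + field_energy h s.

Context (mu : probability (measurableTypeR R) R).

Definition mean_tanh : R := \int[mu]_x tanh x.

Definition P0 (n : nat) (s : config n) : R :=
  \int[iid_law mu n]_h gibbs (field_energy h) s.

Definition PS (theta1 : R) (n : nat) (S : {set 'I_n}) (s : config n) : R :=
  \int[iid_law mu n]_h gibbs (planted_energy theta1 S h) s.

Definition samples (m n : nat) := {ffun 'I_m -> config n}.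

Definition prod_prob (m n : nat) (p : config n -> R)
    (A : pred (samples m n)) : R :=
  \sum_(x : samples m n | A x) \prod_(j < m) p (x j).

(* [psi k] is true on the samples for which the null is rejected. *)
Definition asymptotically_powerful (theta1 : R) (n m : nat -> nat)
    (psi : forall k, pred (samples (m k) (n k))) : Prop :=
  (fun k => prod_prob (@P0 (n k)) (psi k)
     + sup [set prod_prob (PS theta1 S) (predC (psi k))
            | S in [set S : {set 'I_(n k)} | #|S| = k]])
    @ \oo --> (0 : R).

Definition phi9 (k m n : nat) (x : samples m n) : R :=
  m%:R^-1 * k%:R ^- 2 *
    \sum_(j < m) ((\sum_(i < n) spin (x j i) - n%:R * mean_tanh) ^+ 2
                  - n%:R * (1 - mean_tanh ^+ 2)).

End pRFCW.

(* Main.v *)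
Require Import Defs.
From mathcomp Require Import all_boot all_order all_algebra.
From mathcomp Require Import all_classical all_reals all_analysis.
From mathcomp Require Import measurable_realfun ring lra.
Set Implicit Arguments.
Unset Strict Implicit.
Unset Printing Implicit Defensive.
Import Order.TTheory GRing.Theory Num.Theory.
Import numFieldNormedType.Exports.
Local Open Scope classical_set_scope.
Local Open Scope ring_scope.

(** Write [a] for the mean of [tanh h], [X] for the sum of all spins minus
[n a], and [M] for the sum of the spins in the planted set [S], [#|S| = k].
One sample contributes [X ^+ 2 - n (1 - a ^+ 2)] to the statistic; this is the
function [excess] below.

Under the null the spins are independent with mean [a], so the excess is
centred, and its second moment is of order [n ^+ 2], hence of order [k ^+ 4]
when [k] is at least a multiple of the square root of [n].  Under [P_S] a spin
outside [S] still has mean [a] and is independent of all other spins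
([PS_spin_outside]): averaged against a function of the other spins, it only
feels its own field.  Hence the excess has mean
[E (M - k a) ^+ 2 - k (1 - a ^+ 2)] ([mean_excess]), and again a second moment
of order [k ^+ 4] ([mean_sqr_excess_le]).  Averaging over [m] samples,
Chebyshev's inequality bounds both errors by a constant over [m], as soon as
[E (M - k a) ^+ 2 >= c k ^+ 2] for a constant [c > 0]; the threshold may then be
anything up to [c / 4].

This lower bound ([planted_deviation_ge]) is the heart of the matter, and holds
for every positive [theta1] without any study of the mean-field equation.  For
fixed fields, the Gibbs variational inequality ([gibbs_variational]) says that
the mean of the interaction energy [theta1 M ^+ 2 / (2 k)] is at least the
logarithm of the ratio of the partition functions with and without the
interaction.  Since [M ^+ 2 / (2 k) >= a M - k a ^+ 2 / 2], the interaction can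
be replaced in that ratio by a uniform field [t = theta1 a] on [S], for which
the ratio is an explicit product.  Averaging over the fields gives
[E M ^+ 2 >= k ^+ 2 (2 l / theta1 - a ^+ 2)], where [l] is the mean of
[ln (cosh (h + t) / cosh h)].  Strict convexity and [a != 0] give
[l > t E (tanh h) = theta1 a ^+ 2] ([mean_log_cosh_ratio_gt]), so [E M ^+ 2]
exceeds [(k a) ^+ 2] by an amount of order [k ^+ 2].  A random variable whose
norm in L2 exceeds that of the constant [k a] by that much cannot be close to
this constant in L2. *)

(** * Integrals of bounded functions of independent fields *)

Section bounded_measurable.
Context d (T : measurableType d) (R : realType).
Implicit Types f g : T -> R.

(** A class of integrands closed under the ring operations on which Fubini's
theorem and linearity of the integral hold unconditionally. *)
Definition bounded_measurable f :=
  measurable_fun [set: T] f /\ exists M, forall x, `|f x| <= M.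

Lemma bounded_measurable_cst c : bounded_measurable (fun=> c).
Proof. by split; [exact: measurable_cst|exists `|c|]. Qed.

Lemma bounded_measurableD f g : bounded_measurable f -> bounded_measurable g ->
  bounded_measurable (fun x => f x + g x).
Proof.
move=> [mf [M fM]] [mg [N gN]]; split; first exact: measurable_funD.
by exists (M + N) => x; rewrite (le_trans (ler_normD _ _))// lerD.
Qed.

Lemma bounded_measurableM f g : bounded_measurable f -> bounded_measurable g ->
  bounded_measurable (fun x => f x * g x).
Proof.
move=> [mf [M fM]] [mg [N gN]]; split; first exact: measurable_funM.
by exists (M * N) => x; rewrite normrM ler_pM.
Qed.

Lemma bounded_measurable_sum (I : Type) (r : seq I) (P : pred I)
    (F : I -> T -> R) : (forall i, bounded_measurable (F i)) ->
  bounded_measurable (fun x => \sum_(i <- r | P i) F i x).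
Proof.
move=> bF; elim: r => [|i r IHr].
  under eq_fun do rewrite big_nil; exact: bounded_measurable_cst.
under eq_fun do rewrite big_cons.
by case: (P i) => //; exact: bounded_measurableD.
Qed.

Lemma bounded_measurable_integrable (P : probability T R) f :
  bounded_measurable f -> P.-integrable [set: T] (EFin \o f).
Proof.
move=> [mf [M fM]]; apply: measurable_bounded_integrable => //.
  by apply: (@le_lt_trans _ _ 1%E); [exact: probability_le1|rewrite ltry].
exists M; split; first exact: num_real.
by move=> y My x _ /=; rewrite (le_trans (fM x))// ltW.
Qed.

Lemma Rintegral_sum_bounded (P : probability T R) (I : Type) (r : seq I)
    (Q : pred I) (F : I -> T -> R) : (forall i, bounded_measurable (F i)) ->
  \int[P]_x (\sum_(i <- r | Q i) F i x) = \sum_(i <- r | Q i) \int[P]_x F i x.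
Proof.
move=> bF; elim: r => [|i r IHr].
  rewrite big_nil; under eq_Rintegral do rewrite big_nil.
  by rewrite Rintegral_cst// mul0r.
rewrite big_cons; under eq_Rintegral do rewrite big_cons.
case: (Q i) => //; rewrite RintegralD ?IHr//.
  exact: bounded_measurable_integrable.
by apply: bounded_measurable_integrable; exact: bounded_measurable_sum.
Qed.

Lemma Rintegral_probability_cst (P : probability T R) c : \int[P]_x c = c.
Proof.
rewrite Rintegral_cst// [X in fine X](_ : _ = 1%E) ?mulr1//.
exact: probability_setT.
Qed.

Lemma normr_Rintegral_le (P : probability T R) f M :
  measurable_fun [set: T] f -> (forall x, `|f x| <= M) ->
  `|\int[P]_x f x| <= M.
Proof.
move=> mf fM; have bf : bounded_measurable f by split; last by exists M.
rewrite (le_trans (le_normr_Rintegral _ _))//.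
  exact: bounded_measurable_integrable.
rewrite -[leRHS](Rintegral_probability_cst P); apply: le_Rintegral => //.
- apply: bounded_measurable_integrable; split; first exact: measurableT_comp.
  by exists M => x; rewrite normr_id.
- by apply: bounded_measurable_integrable; exact: bounded_measurable_cst.
Qed.

(** A nonnegative function with zero integral vanishes almost everywhere, and
the empty set does not have full measure. *)
Lemma Rintegral_gt0 (P : probability T R) f : bounded_measurable f ->
  (forall x, 0 < f x) -> 0 < \int[P]_x f x.
Proof.
move=> bf f0; rewrite lt_neqAle Rintegral_ge0 ?andbT; last first.
  by move=> x _; exact: ltW.
have [mf _] := bf; have if1 := bounded_measurable_integrable P bf.
apply/negP => /eqP/esym int0.
have : (\int[P]_(x in [set: T]) `|(f x)%:E|)%E = 0%E.
  under eq_integral do rewrite gee0_abs ?lee_fin ?(ltW (f0 _))//.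
  by rewrite -[LHS]fineK ?integrable_fin_num// -[0%E]/(0%:E) -int0.
move/ae_eq_integral_abs => -[]//; first exact/measurable_EFinP.
move=> A [mA PA0 sA].
have AT : A = setT.
  apply/seteqP; split=> // x _; apply: sA => /= /(_ I) [] fx0.
  by have := f0 x; rewrite fx0 ltxx.
have := @probability_setT _ _ _ P; rewrite -AT => /esym/eqP.
by rewrite [X in _ == X]PA0 onee_eq0.
Qed.

End bounded_measurable.

Section iid_integral.
Context d (T : measurableType d) (R : realType) (mu : probability T R).

Lemma bounded_measurable_cons n (f : n.+1.-tuple T -> R) (x : T) :
  bounded_measurable f ->
  bounded_measurable (fun t : n.-tuple T => f (cons_pair (x, t))).
Proof.
move=> [mf [M fM]]; split; last by exists M.
by apply: measurableT_comp => //; apply: measurableT_comp => //;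
  exact: measurable_cons_pair.
Qed.

Lemma integrable_cons_pair n (f : n.+1.-tuple T -> R) : bounded_measurable f ->
  (mu \x iid_law mu n)%E.-integrable setT (EFin \o (f \o @cons_pair _ T n)).
Proof.
move=> [mf [M fM]]; apply: bounded_measurable_integrable.
split; last by exists M => x; exact: fM.
by apply: measurableT_comp => //; exact: measurable_cons_pair.
Qed.

Lemma iid_integralS n (f : n.+1.-tuple T -> R) : bounded_measurable f ->
  \int[iid_law mu n.+1]_t f t =
  \int[mu]_x \int[iid_law mu n]_t f (cons_pair (x, t)).
Proof.
move=> bf; have [mf [M fM]] := bf.
have ifc := integrable_cons_pair bf.
rewrite /Rintegral /=; congr fine.
rewrite integral_distribution; last 2 first.
- exact/measurable_EFinP.
- exact: ifc.
rewrite -integral12_prod_meas1//.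
apply: eq_integral => x _; rewrite /fubini_F /= fineK//.
apply: integrable_fin_num => //.
by apply: bounded_measurable_integrable; exact: bounded_measurable_cons.
Qed.

Lemma bounded_measurable_Rintegral n (f : n.+1.-tuple T -> R) :
  bounded_measurable f ->
  bounded_measurable
    (fun x => \int[iid_law mu n]_t f (cons_pair (x, t))).
Proof.
move=> bf; have [mf [M fM]] := bf.
have ifc := integrable_cons_pair bf.
split.
  apply: (measurableT_comp (fine_measurable measurableT)) => //.
  exact: (measurable_fubini_F ifc).
exists M => x; have [mx _] := bounded_measurable_cons x bf.
by apply: normr_Rintegral_le => // t; exact: fM.
Qed.

(** Independence of one coordinate from the others, by Fubini's theorem: it is
stated for a function that ignores the coordinate, which avoids splitting the
tuple. *)
Lemma iid_integral_indep n (i : 'I_n) (F : n.-tuple T -> R) (g : T -> R) :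
  bounded_measurable F -> bounded_measurable g ->
  (forall t t' : n.-tuple T,
     (forall j, j != i -> tnth t j = tnth t' j) -> F t = F t') ->
  \int[iid_law mu n]_t (F t * g (tnth t i)) =
  (\int[iid_law mu n]_t F t) * \int[mu]_x g x.
Proof.
elim: n i F => [|n IHn] i F bF bg Fi; first by have := ltn_ord i.
have bFg : bounded_measurable (fun t => F t * g (tnth t i)).
  apply: bounded_measurableM => //; have [mg [M gM]] := bg.
  split; last by exists M.
  by apply: measurableT_comp => //; exact: measurable_tnth.
have bFc x := bounded_measurable_cons x bF.
rewrite !iid_integralS//; case: (unliftP ord0 i) => [j|] iE; subst i; clear bFg.
  under eq_Rintegral => x _.
    under eq_Rintegral do rewrite tnthS.
    rewrite IHn//; last first.
      move=> t t' tt'; apply: Fi => l.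
      case: (unliftP ord0 l) => [l' ->|-> //]; rewrite !tnthS => ll'.
      by apply: tt'; apply: contraNneq ll' => ->.
    over.
  rewrite RintegralZr//; apply: bounded_measurable_integrable.
  exact: bounded_measurable_Rintegral.
(* here the inner integral of F does not depend on the first coordinate *)
have FE x y t : F (cons_pair (x, t)) = F (cons_pair (y, t)).
  apply: Fi => l; case: (unliftP ord0 l) => [l' -> _|-> /eqP//].
  by rewrite !tnthS.
have inner x y : \int[iid_law mu n]_t F (cons_pair (x, t)) =
    \int[iid_law mu n]_t F (cons_pair (y, t)).
  by apply: eq_Rintegral => t _; exact: FE.
pose c := \int[iid_law mu n]_t F (cons_pair (point, t)).
under eq_Rintegral => x _.
  under eq_Rintegral do rewrite tnth0 /=.
  rewrite RintegralZr; [|by []|exact: bounded_measurable_integrable].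
  rewrite (inner x point) -/c; over.
rewrite RintegralZl//; last exact: bounded_measurable_integrable.
congr (_ * _); under eq_Rintegral => x _ do rewrite (inner x point).
by rewrite Rintegral_probability_cst.
Qed.

Lemma iid_integral1 n (i : 'I_n) (g : T -> R) : bounded_measurable g ->
  \int[iid_law mu n]_t g (tnth t i) = \int[mu]_x g x.
Proof.
move=> bg.
have := @iid_integral_indep n i (fun=> 1) g (bounded_measurable_cst _ _) bg
  (fun _ _ _ => erefl).
rewrite Rintegral_probability_cst mul1r => <-.
by apply: eq_Rintegral => t _; rewrite mul1r.
Qed.

End iid_integral.

(** * Chebyshev's inequality for independent samples *)

Section product_sampling.
Context (R : realType).

Lemma prod_weight_cov (I : finType) m (p g : I -> R) (j l : 'I_m) :
  \sum_s p s = 1 -> \sum_s p s * g s = 0 ->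
  \sum_(x : {ffun 'I_m -> I}) (\prod_(i < m) p (x i)) * (g (x j) * g (x l)) =
  (\sum_s p s * g s ^+ 2) *+ (j == l).
Proof.
move=> p1 pg0.
(* put each factor g on its own coordinate, so that the sum of products
   factorizes *)
pose F (i : 'I_m) s := p s * (if i == j then g s else 1)
                           * (if i == l then g s else 1).
transitivity (\sum_(x : {ffun 'I_m -> I}) \prod_(i < m) F i (x i)).
  apply: eq_bigr => x _; rewrite /F !big_split /= -mulrA.
  by congr (_ * (_ * _)); rewrite -big_mkcond big_pred1_eq.
rewrite -(bigA_distr_bigA F) /= (bigD1 j)//= /F eqxx.
have [<-|jl] := eqVneq j l; last first.
  rewrite [X in X * _](_ : _ = 0) ?mul0r//.
  by rewrite -[RHS]pg0; apply: eq_bigr => s _; rewrite mulr1.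
rewrite [X in _ * X]big1 ?mulr1 => [|i /negPf ->].
  by apply: eq_bigr => s _; rewrite -mulrA expr2.
by under eq_bigr do rewrite !mulr1.
Qed.

(** Variances of independent centred terms add up. *)
Lemma prod_weight_sum_sqr (I : finType) m (p g : I -> R) :
  \sum_s p s = 1 -> \sum_s p s * g s = 0 ->
  \sum_(x : {ffun 'I_m -> I})
    (\prod_(i < m) p (x i)) * (\sum_(j < m) g (x j)) ^+ 2 =
  m%:R * \sum_s p s * g s ^+ 2.
Proof.
move=> p1 pg0.
transitivity (\sum_(x : {ffun 'I_m -> I}) \sum_(j < m) \sum_(l < m)
    (\prod_(i < m) p (x i)) * (g (x j) * g (x l))).
  apply: eq_bigr => x _; rewrite expr2 big_distrlr /= mulr_sumr.
  by apply: eq_bigr => j _; rewrite mulr_sumr.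
rewrite exchange_big /= mulr_natl -[X in _ *+ X](card_ord m) -sumr_const.
apply: eq_bigr => j _; rewrite exchange_big /=.
under eq_bigr do rewrite prod_weight_cov//.
rewrite [LHS](bigD1 j)//= eqxx [X in _ + X]big1 ?addr0// => l.
by rewrite eq_sym => /negPf ->.
Qed.

Lemma prod_prob_chebyshev m n (p g : config n -> R) (A : pred (samples m n))
    (eps : R) : (forall s, 0 <= p s) -> \sum_s p s = 1 ->
  \sum_s p s * g s = 0 -> (0 < m)%N -> 0 < eps ->
  (forall x, A x -> m%:R * eps <= `|\sum_(j < m) g (x j)|) ->
  prod_prob p A <= (\sum_s p s * g s ^+ 2) / (m%:R * eps ^+ 2).
Proof.
move=> p0 p1 pg0 m0 e0 Ag.
have m0R : 0 < m%:R :> R by rewrite ltr0n.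
have prod0 (x : samples m n) : 0 <= \prod_(j < m) p (x j) by exact: prodr_ge0.
rewrite ler_pdivlMr ?mulr_gt0 ?exprn_gt0//.
rewrite -(ler_pM2l m0R) -prod_weight_sum_sqr// /prod_prob.
rewrite mulrCA mulr_suml [leRHS](bigID A) /= -[leLHS]addr0 lerD//; last first.
  by apply: sumr_ge0 => x _; rewrite mulr_ge0// sqr_ge0.
apply: ler_sum => x Ax; apply: ler_wpM2l => //.
rewrite mulrA -expr2 -exprMn -[leRHS]real_normK ?num_real//.
by rewrite lerXn2r ?nnegrE ?Ag// mulr_ge0 ?ltW.
Qed.

Lemma prod_prob_ge0 m n (p : config n -> R) (A : pred (samples m n)) :
  (forall s, 0 <= p s) -> 0 <= prod_prob p A.
Proof. by move=> p0; apply: sumr_ge0 => x _; exact: prodr_ge0. Qed.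

End product_sampling.

(** * Finite Gibbs measures and spin flips *)

Section gibbs.
Context (R : realType).

Definition partition_function n (H : config n -> R) := \sum_s expR (H s).

Lemma partition_function_gt0 n (H : config n -> R) : 0 < partition_function H.
Proof.
rewrite /partition_function (bigD1 [ffun=> true])//=.
by rewrite ltr_pwDl ?expR_gt0// sumr_ge0// => s _; exact: expR_ge0.
Qed.

Lemma gibbs_ge0 n (H : config n -> R) s : 0 <= gibbs H s.
Proof. by rewrite divr_ge0 ?expR_ge0// ltW// partition_function_gt0. Qed.

Lemma gibbs_sum1 n (H : config n -> R) : \sum_s gibbs H s = 1.
Proof.
by rewrite -mulr_suml divff// gt_eqF// partition_function_gt0.
Qed.

Lemma gibbs_le1 n (H : config n -> R) s : gibbs H s <= 1.
Proof.
rewrite -(gibbs_sum1 H) (bigD1 s)//= lerDl sumr_ge0// => t _.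
exact: gibbs_ge0.
Qed.

Lemma gibbs_mean n (H G : config n -> R) :
  \sum_s gibbs H s * G s = (\sum_s expR (H s) * G s) / partition_function H.
Proof. by rewrite mulr_suml; apply: eq_bigr => s _; rewrite mulrAC. Qed.

Definition flip n (i : 'I_n) (s : config n) : config n :=
  [ffun j => if j == i then ~~ s j else s j].

Lemma flipK n (i : 'I_n) : involutive (@flip n i).
Proof.
by move=> s; apply/ffunP => j; rewrite !ffunE; case: eqP => // _; rewrite negbK.
Qed.

Lemma spin_flip n (i : 'I_n) s : spin R (flip i s i) = - spin R (s i).
Proof. by rewrite ffunE eqxx; case: (s i); rewrite /spin ?opprK. Qed.

Lemma spin_flip_neq n (i j : 'I_n) s : j != i -> flip i s j = s j.
Proof. by move=> /negPf ji; rewrite ffunE ji. Qed.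

Lemma spin_sqr b : spin R b ^+ 2 = 1.
Proof. by case: b; rewrite /spin ?expr1n// sqrrN expr1n. Qed.

Lemma spin_norm b : `|spin R b| = 1.
Proof. by case: b; rewrite /spin ?normrN normr1. Qed.

(** Pairing every configuration with its flip at [i]. *)
Lemma sum_flip n (i : 'I_n) (F : config n -> R) :
  \sum_s F s = (\sum_s (F s + F (flip i s))) / 2.
Proof.
rewrite big_split /=; have <- : \sum_s F s = \sum_s F (flip i s).
  exact: (reindex_inj (can_inj (flipK i))).
by rewrite -mulr2n -[_ *+ 2]mulr_natr mulfK.
Qed.

Lemma sum_expR_spin n (i : 'I_n) (K : config n -> R) (x : R) :
  (forall s, K (flip i s) = K s) ->
  \sum_(s : config n) expR (x * spin R (s i)) * K s =
  (expR x + expR (- x)) / 2 * \sum_s K s.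
Proof.
move=> Ki; rewrite [LHS](sum_flip i) [RHS]mulrAC mulr_sumr; congr (_ / _).
apply: eq_bigr => s _; rewrite Ki spin_flip -mulrDl; congr (_ * _).
by case: (s i); rewrite /spin ?opprK mulr1 mulrN1// addrC.
Qed.

Lemma sum_expR_spinM n (i : 'I_n) (K : config n -> R) (x : R) :
  (forall s, K (flip i s) = K s) ->
  \sum_(s : config n) expR (x * spin R (s i)) * K s * spin R (s i) =
  (expR x - expR (- x)) / 2 * \sum_s K s.
Proof.
move=> Ki; rewrite [LHS](sum_flip i) [RHS]mulrAC mulr_sumr; congr (_ / _).
apply: eq_bigr => s _; rewrite Ki spin_flip.
by case: (s i); rewrite /spin ?opprK !mulr1 ?mulrN1; ring.
Qed.

Lemma two_cosh_gt0 (x : R) : 0 < expR x + expR (- x).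
Proof. by rewrite addr_gt0 ?expR_gt0. Qed.

Lemma tanh_lt1 (x : R) : `|tanh x| < 1.
Proof.
have c0 := two_cosh_gt0 x.
rewrite normrM normfV (gtr0_norm c0) ltr_pdivrMr// mul1r ltr_norml.
by have := expR_gt0 x; have := expR_gt0 (- x); lra.
Qed.

Lemma bounded_measurable_tanh :
  @bounded_measurable _ (measurableTypeR R) R (@tanh R).
Proof.
split; last by exists 1 => x; rewrite ltW// tanh_lt1.
have me : measurable_fun [set: measurableTypeR R] (@expR R).
  exact: measurable_expR.
have mne : measurable_fun [set: measurableTypeR R] (fun x : R => expR (- x)).
  by apply: measurableT_comp => //; exact: measurable_funN.
(* the inverse written with exp and ln is a composition of measurable maps *)
rewrite [X in measurable_fun _ X](_ : _ = fun x : R =>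
    (expR x - expR (- x)) * expR (- ln (expR x + expR (- x)))).
  apply: measurable_funM; first exact: measurable_funB.
  apply: measurableT_comp => //; apply: measurable_funN.
  apply: measurableT_comp; first exact: measurable_ln.
  exact: measurable_funD.
apply/funext => x; rewrite /tanh; congr (_ * _).
by rewrite [RHS]expRN lnK// posrE two_cosh_gt0.
Qed.

End gibbs.

(** * The planted law and the spins outside the planted set *)

Section planted_law.
Context (R : realType) (mu : probability (measurableTypeR R) R) (theta1 : R).
Context (n : nat) (S : {set 'I_n}).

Let inter (s : config n) : R := theta1 / (2 * #|S|%:R) *
  (\sum_(i in S) \sum_(j in S) spin R (s i) * spin R (s j)).

Lemma measurable_planted_energy s :
  measurable_fun [set: n.-tuple (measurableTypeR R)]
    (fun h => planted_energy theta1 S h s).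
Proof.
apply: measurable_funD; first exact: measurable_cst.
apply: measurable_sum => i; apply: measurable_funM => //.
exact: measurable_tnth.
Qed.

Lemma bounded_measurable_gibbs s :
  @bounded_measurable _ (n.-tuple (measurableTypeR R)) R
    (fun h => gibbs (planted_energy theta1 S h) s).
Proof.
split; last first.
  by exists 1 => h; rewrite ger0_norm ?gibbs_ge0// gibbs_le1.
rewrite [X in measurable_fun _ X](_ : _ = fun h : n.-tuple R =>
  expR (planted_energy theta1 S h s
        - ln (partition_function (planted_energy theta1 S h)))).
  apply: measurableT_comp => //; apply: measurable_funB.
    exact: measurable_planted_energy.
  apply: measurableT_comp; first exact: measurable_ln.
  apply: measurable_sum => t; apply: measurableT_comp => //.
  exact: measurable_planted_energy.
apply/funext => h; rewrite expRD expRN lnK//.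
by rewrite posrE partition_function_gt0.
Qed.

Lemma bounded_measurable_gibbs_mean (G : config n -> R) :
  @bounded_measurable _ (n.-tuple (measurableTypeR R)) R
    (fun h => \sum_s gibbs (planted_energy theta1 S h) s * G s).
Proof.
apply: bounded_measurable_sum => s; apply: bounded_measurableM.
  exact: bounded_measurable_gibbs.
exact: bounded_measurable_cst.
Qed.

Lemma PS_mean (G : config n -> R) :
  \sum_s PS mu theta1 S s * G s =
  \int[iid_law mu n]_h \sum_s gibbs (planted_energy theta1 S h) s * G s.
Proof.
rewrite Rintegral_sum_bounded; last first.
  move=> s; apply: bounded_measurableM; first exact: bounded_measurable_gibbs.
  exact: bounded_measurable_cst.
apply: eq_bigr => s _; rewrite RintegralZr//.
apply: bounded_measurable_integrable; exact: bounded_measurable_gibbs.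
Qed.

Lemma PS_ge0 s : 0 <= PS mu theta1 S s.
Proof. by apply: Rintegral_ge0 => h _; exact: gibbs_ge0. Qed.

Lemma PS_sum1 : \sum_s PS mu theta1 S s = 1.
Proof.
under eq_bigr do rewrite -[PS _ _ _ _]mulr1.
rewrite PS_mean; under eq_Rintegral => h _.
  by under eq_bigr do rewrite mulr1; rewrite gibbs_sum1; over.
exact: Rintegral_probability_cst.
Qed.

Section outside_spin.
Variables (i : 'I_n) (G : config n -> R).
Hypotheses (iS : i \notin S) (Gi : forall s, G (flip i s) = G s).

(* the Boltzmann weight of all terms that do not involve the spin at i *)
Let K (h : n.-tuple R) (s : config n) :=
  expR (inter s + \sum_(j < n | j != i) tnth h j * spin R (s j)).

Let planted_energyE h s : expR (planted_energy theta1 S h s) =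
  expR (tnth h i * spin R (s i)) * K h s.
Proof.
rewrite -expRD /planted_energy [field_energy _ _](bigD1 i)//=.
by rewrite addrCA.
Qed.

Let interflip s : inter (flip i s) = inter s.
Proof.
rewrite /inter; congr (_ * _).
apply: eq_bigr => j jS; apply: eq_bigr => l lS.
by rewrite !spin_flip_neq//; [apply: contraNneq iS => <-..].
Qed.

Let Kflip h s : K h (flip i s) = K h s.
Proof.
rewrite /K interflip; congr (expR (_ + _)).
by apply: eq_bigr => j ji; rewrite spin_flip_neq.
Qed.

Let KGflip h s : K h (flip i s) * G (flip i s) = K h s * G s.
Proof. by rewrite Kflip Gi. Qed.

Let Zi h : partition_function (planted_energy theta1 S h) =
  (expR (tnth h i) + expR (- tnth h i)) / 2 * \sum_s K h s.
Proof.
rewrite -(sum_expR_spin _ (Kflip h)); apply: eq_bigr => s _.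
exact: planted_energyE.
Qed.

Let K_gt0 h : 0 < \sum_s K h s.
Proof.
have := partition_function_gt0 (planted_energy theta1 S h).
rewrite Zi pmulr_rgt0// divr_gt0//; exact: two_cosh_gt0.
Qed.

(* the field at i cancels between numerator and denominator: the mean of G
   does not depend on it *)
Let gibbs_mean_outside h : \sum_s gibbs (planted_energy theta1 S h) s * G s =
  (\sum_s K h s * G s) / \sum_s K h s.
Proof.
rewrite gibbs_mean Zi.
under eq_bigr do rewrite planted_energyE -mulrA.
rewrite (sum_expR_spin _ (KGflip h)); have := K_gt0 h.
have := two_cosh_gt0 (tnth h i) => c0 k0.
by field; rewrite !gt_eqF.
Qed.

Let gibbs_spin_outside h :
  \sum_s gibbs (planted_energy theta1 S h) s * (spin R (s i) * G s) =
  (\sum_s gibbs (planted_energy theta1 S h) s * G s) * tanh (tnth h i).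
Proof.
rewrite gibbs_mean_outside gibbs_mean Zi /tanh.
have -> : \sum_s expR (planted_energy theta1 S h s) * (spin R (s i) * G s) =
    \sum_(s : config n)
      expR (tnth h i * spin R (s i)) * (K h s * G s) * spin R (s i).
  by apply: eq_bigr => s _; rewrite planted_energyE; ring.
rewrite (sum_expR_spinM _ (KGflip h)); have := K_gt0 h.
have := two_cosh_gt0 (tnth h i) => c0 k0.
by field; rewrite !gt_eqF.
Qed.

(** For fixed fields, the mean of [spin (s i) * G] is [tanh (h i)] times the mean
of [G], and the latter does not depend on [h i]; so integrating over [h i]
replaces [tanh (h i)] by its mean. *)
Lemma PS_spin_outside :
  \sum_s PS mu theta1 S s * ((spin R (s i) - mean_tanh mu) * G s) = 0.
Proof.
under eq_bigr do rewrite mulrBl mulrBr.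
rewrite sumrB !PS_mean; apply/eqP; rewrite subr_eq0; apply/eqP.
under eq_Rintegral do rewrite gibbs_spin_outside.
rewrite iid_integral_indep; last 3 first.
- exact: bounded_measurable_gibbs_mean.
- exact: bounded_measurable_tanh.
- move=> h h' hh'; rewrite !gibbs_mean_outside.
  have KE s : K h s = K h' s.
    congr (expR (_ + _)); apply: eq_bigr => j ji.
    by rewrite hh'.
  by congr (_ / _); apply: eq_bigr => s _; rewrite KE.
rewrite mulrC -/(mean_tanh mu).
rewrite -RintegralZl//; last first.
  by apply: bounded_measurable_integrable; exact: bounded_measurable_gibbs_mean.
apply: eq_Rintegral => h _; rewrite mulr_sumr.
by apply: eq_bigr => s _; rewrite mulrCA.
Qed.

End outside_spin.
End planted_law.

(** The null law is the planted law of the empty set, so that the moment bounds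
under the null are instances of those under the alternative. *)
Lemma P0_PS (R : realType) (mu : probability (measurableTypeR R) R)
  (theta1 : R) n : @P0 R mu n = PS mu theta1 (finset.set0 : {set 'I_n}).
Proof.
apply/funext => s; congr (Rintegral _ _ _); apply/funext => h.
congr (gibbs _ s); apply/funext => t.
by rewrite /planted_energy big_set0 mulr0 add0r.
Qed.

(** * Moments of the magnetization *)

Section centred_spins.
Context (R : realType) (n : nat) (p : config n -> R) (S : {set 'I_n}) (a : R).
Context (p0 : forall s, 0 <= p s) (p1 : \sum_s p s = 1) (a1 : `|a| <= 1).
Context (pS : forall i (G : config n -> R), i \notin S ->
  (forall s, G (flip i s) = G s) ->
  \sum_s p s * ((spin R (s i) - a) * G s) = 0).

Let E (f : config n -> R) := \sum_s p s * f s.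

Let ED f g : E (fun s => f s + g s) = E f + E g.
Proof. by rewrite /E -big_split; apply: eq_bigr => s _; rewrite mulrDr. Qed.

Let EZ c f : E (fun s => c * f s) = c * E f.
Proof. by rewrite /E mulr_sumr; apply: eq_bigr => s _; rewrite mulrCA. Qed.

Let Ecst c : E (fun=> c) = c.
Proof. by rewrite /E -mulr_suml p1 mul1r. Qed.

Let leE f g : (forall s, f s <= g s) -> E f <= E g.
Proof. by move=> fg; apply: ler_sum => s _; exact: ler_wpM2l. Qed.

Let eqE f g : f =1 g -> E f = E g.
Proof. by move=> fg; apply: eq_bigr => s _; rewrite fg. Qed.

Let Y (r : seq 'I_n) (s : config n) := \sum_(i <- r) (spin R (s i) - a).

Let Yflip i r s : i \notin r -> Y r (flip i s) = Y r s.
Proof.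
move=> ir; apply: eq_big_seq => j jr.
by rewrite spin_flip_neq//; apply: contraNneq ir => <-.
Qed.

(* a function of one spin is affine in it, so that pS gives the variance *)
Let centred_sqr i (s : config n) :
  (spin R (s i) - a) ^+ 2 = (1 - a ^+ 2) - 2 * a * (spin R (s i) - a).
Proof. by have := spin_sqr R (s i) => e; rewrite sqrrB e; ring. Qed.

Let centred_sqr_le4 i (s : config n) : (spin R (s i) - a) ^+ 2 <= 4.
Proof.
move: a1; rewrite ler_norml => /andP[? ?].
by case: (s i); rewrite /spin; nra.
Qed.

Let Esqr i : i \notin S -> E (fun s => (spin R (s i) - a) ^+ 2) = 1 - a ^+ 2.
Proof.
move=> iS.
rewrite (eqE (g := fun s => (1 - a ^+ 2) + - (2 * a) * ((spin R (s i) - a) * 1))).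
  by rewrite ED EZ Ecst [E _]pS ?mulr0 ?addr0.
by move=> s; rewrite centred_sqr; ring.
Qed.

Lemma mean_sqr_sum_outside (r : seq 'I_n) :
  uniq r -> (forall i, i \in r -> i \notin S) ->
  \sum_s p s * (\sum_(i <- r) (spin R (s i) - a)) ^+ 2 =
  (size r)%:R * (1 - a ^+ 2).
Proof.
elim: r => [_ _|i r IHr /= /andP[ir ur] rS].
  by rewrite mul0r big1// => s _; rewrite big_nil expr0n mulr0.
have iS : i \notin S by apply: rS; rewrite mem_head.
rewrite -[LHS]/(E (fun s => Y (i :: r) s ^+ 2)).
rewrite (eqE (g := fun s => (Y r s ^+ 2 + 2 * ((spin R (s i) - a) * Y r s))
   + (spin R (s i) - a) ^+ 2)); last first.
  by move=> s; rewrite /Y big_cons; ring.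
rewrite !ED EZ Esqr// [X in 2 * X]pS//; last by move=> s; exact: Yflip.
rewrite [E _]IHr// ?mulr0 ?addr0 -?natr1 ?mulrDl ?mul1r// => j jr.
by apply: rS; rewrite inE jr orbT.
Qed.

(** Adding a centred independent spin [x] to the sum [y] raises the fourth moment
by at most [32 * E (y ^+ 2) + 48]: the term in [y ^+ 3 * x] has mean zero, and
the other mixed terms are absorbed using [x ^+ 2 <= 4]. *)
Lemma mean_pow4_sum_outside (r : seq 'I_n) :
  uniq r -> (forall i, i \in r -> i \notin S) ->
  \sum_s p s * (\sum_(i <- r) (spin R (s i) - a)) ^+ 4 <=
  48 * (size r)%:R ^+ 2.
Proof.
elim: r => [_ _|i r IHr /= /andP[ir ur] rS].
  by rewrite expr0n mulr0 big1// => s _; rewrite big_nil expr0n mulr0.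
have iS : i \notin S by apply: rS; rewrite mem_head.
have rS' j : j \in r -> j \notin S by move=> jr; apply: rS; rewrite inE jr orbT.
have le4 := IHr ur rS'; have eq2 := mean_sqr_sum_outside ur rS'.
rewrite -[leLHS]/(E (fun s => Y (i :: r) s ^+ 4)).
apply: (@le_trans _ _ (E (fun s => (Y r s ^+ 4
    + 4 * ((spin R (s i) - a) * Y r s ^+ 3)) + (32 * Y r s ^+ 2 + 48)))).
  apply: leE => s; rewrite /Y big_cons -/(Y r s).
  have := centred_sqr_le4 i s; set x := spin R (s i) - a; set y := Y r s => x4.
  rewrite -subr_ge0 [leRHS](_ : _ = 2 * x ^+ 2 * (y - x) ^+ 2
     + (8 * y ^+ 2 + 3 * (4 + x ^+ 2)) * (4 - x ^+ 2)); last by ring.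
  have x0 := sqr_ge0 x; have y0 := sqr_ge0 y; have xy0 := sqr_ge0 (y - x).
  by apply: addr_ge0; apply: mulr_ge0 => //; lra.
rewrite !ED !EZ [X in 4 * X]pS//; last by move=> s; rewrite Yflip.
rewrite Ecst [E (fun s => Y r s ^+ 2)]eq2 mulr0 addr0.
have s0 : 0 <= (size r)%:R :> R by [].
have a0 : 0 <= a ^+ 2 by exact: sqr_ge0.
rewrite -natr1 (le_trans (lerD le4 (lexx _)))//.
by nra.
Qed.

Let inside (s : config n) := \sum_(i in S) (spin R (s i) - a).
Let outside (s : config n) := \sum_(i in ~: S) (spin R (s i) - a).

Let insideflip i s : i \notin S -> inside (flip i s) = inside s.
Proof.
move=> iS; apply: eq_bigr => j jS.
by rewrite spin_flip_neq//; apply: contraNneq iS => <-.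
Qed.

Let splitE (s : config n) :
  \sum_(i < n) spin R (s i) - n%:R * a = inside s + outside s.
Proof.
transitivity (\sum_(i < n) (spin R (s i) - a)).
  by rewrite sumrB sumr_const card_ord mulr_natl.
rewrite (bigID (mem S)) /=; congr (_ + _).
by apply: eq_bigl => i; rewrite inE.
Qed.

Let outsideE s : outside s = Y (enum (~: S)) s.
Proof. by rewrite /Y big_enum. Qed.

Let enumS i : i \in enum (~: S) -> i \notin S.
Proof. by rewrite mem_enum inE. Qed.

Let size_enumS : (size (enum (~: S)))%:R = n%:R - #|S|%:R :> R.
Proof.
rewrite -cardE cardsCs finset.setCK card_ord natrB//.
by rewrite -[X in (_ <= X)%N]card_ord max_card.
Qed.

(** The spins outside [S] are uncorrelated with each other and with those in
[S], so they only add their own variances. *)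
Lemma mean_sqr_magnetization :
  \sum_s p s * (\sum_(i < n) spin R (s i) - n%:R * a) ^+ 2 =
  \sum_s p s * (\sum_(i in S) (spin R (s i) - a)) ^+ 2
  + (n%:R - #|S|%:R) * (1 - a ^+ 2).
Proof.
rewrite -[LHS]/(E _) (eqE (g := fun s => inside s ^+ 2 +
    (2 * \sum_(i in ~: S) ((spin R (s i) - a) * inside s) + outside s ^+ 2))).
  rewrite !ED EZ; congr (_ + _).
  rewrite [X in 2 * X](_ : _ = 0) ?mulr0 ?add0r.
    rewrite (eqE (g := fun s => Y (enum (~: S)) s ^+ 2)).
      rewrite -size_enumS; apply: mean_sqr_sum_outside => //.
      exact: enum_uniq.
    by move=> s; rewrite outsideE.
  rewrite /E; under eq_bigr do rewrite mulr_sumr.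
  rewrite exchange_big big1// => i; rewrite inE => iS; apply: pS => // s.
  exact: insideflip.
by move=> s; rewrite splitE -mulr_suml -/(outside s); ring.
Qed.

Lemma mean_pow4_magnetization :
  \sum_s p s * (\sum_(i < n) spin R (s i) - n%:R * a) ^+ 4 <=
  128 * #|S|%:R ^+ 4 + 384 * n%:R ^+ 2.
Proof.
apply: (@le_trans _ _ (E (fun s => 128 * #|S|%:R ^+ 4 + 8 * outside s ^+ 4))).
  apply: leE => s; rewrite splitE.
  have ins : `|inside s| <= 2 * #|S|%:R.
    rewrite (le_trans (ler_norm_sum _ _ _))// mulr_natr -sumr_const.
    apply: ler_sum => i _; rewrite (le_trans (ler_normB _ _))//.
    by rewrite spin_norm; have := a1; lra.
  have ins2 : inside s ^+ 2 <= 4 * #|S|%:R ^+ 2.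
    rewrite -[leLHS]real_normK ?num_real//.
    rewrite (_ : 4 * _ = (2 * #|S|%:R) ^+ 2); last by ring.
    by rewrite lerXn2r ?nnegrE ?normr_ge0.
  have ins4 : inside s ^+ 4 <= 16 * #|S|%:R ^+ 4.
    rewrite (_ : inside s ^+ 4 = (inside s ^+ 2) ^+ 2); last by rewrite -exprM.
    rewrite (_ : 16 * _ = (4 * #|S|%:R ^+ 2) ^+ 2); last by ring.
    by rewrite lerXn2r ?nnegrE ?sqr_ge0.
  rewrite (_ : 128 * _ = 8 * (16 * #|S|%:R ^+ 4)); last by ring.
  rewrite (@le_trans _ _ (8 * (inside s ^+ 4 + outside s ^+ 4)))//.
    set x := inside s; set y := outside s; rewrite -subr_ge0.
    rewrite (_ : _ - _ = (x - y) ^+ 2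
        * (7 * x ^+ 2 + 10 * x * y + 7 * y ^+ 2)); last by ring.
    rewrite mulr_ge0 ?sqr_ge0//.
    have := sqr_ge0 (x + y); have := sqr_ge0 x; have := sqr_ge0 y; nra.
  by rewrite mulrDr lerD2r ler_pM2l.
rewrite ED Ecst EZ; rewrite lerD2l.
have -> : E (fun s => outside s ^+ 4) = E (fun s => Y (enum (~: S)) s ^+ 4).
  by apply: eqE => s; rewrite outsideE.
have := mean_pow4_sum_outside (enum_uniq _) enumS; rewrite size_enumS.
rewrite -/(E (fun s => Y (enum (~: S)) s ^+ 4)).
have : #|S|%:R <= n%:R :> R.
  by rewrite ler_nat -[X in (_ <= X)%N]card_ord max_card.
have : 0 <= #|S|%:R :> R by [].
move: (E _) (#|S|%:R) (n%:R) => e k N; nra.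
Qed.

End centred_spins.

(** * The magnetization of the planted set is far from its null mean *)

Section magnetization_gap.
Context (R : realType).

Definition log_cosh_ratio (t x : R) : R :=
  ln ((expR (x + t) + expR (- (x + t))) / (expR x + expR (- x))).

Lemma expR_log_cosh_ratio t x : expR (log_cosh_ratio t x) =
  (expR (x + t) + expR (- (x + t))) / (expR x + expR (- x)).
Proof. by rewrite lnK// posrE divr_gt0// two_cosh_gt0. Qed.

Lemma log_cosh_ratio_norm t x : `|log_cosh_ratio t x| <= `|t|.
Proof.
have x0 := expR_gt0 x; have nx0 := expR_gt0 (- x).
have t1 : expR t <= expR `|t| by rewrite ler_expR ler_norm.
have t2 : expR (- t) <= expR `|t| by rewrite ler_expR -normrN ler_norm.
have t3 : expR (- `|t|) <= expR t by rewrite ler_expR lerNl -normrN ler_norm.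
have t4 : expR (- `|t|) <= expR (- t) by rewrite ler_expR lerN2 ler_norm.
rewrite ler_norml -ler_expR -[in X in _ && X]ler_expR expR_log_cosh_ratio.
rewrite opprD !expRD ler_pdivlMr ?ler_pdivrMr ?two_cosh_gt0//.
by apply/andP; split; nra.
Qed.

(** This is [ln (cosh (x + t)) > ln (cosh x) + t * tanh x], i.e. the strict
convexity of [ln cosh].  With the weights [q] and [r] of the two spin values in
the field [x], the ratio of the hyperbolic cosines is
[q * expR t + r * expR (- t)] and [tanh x = q - r], so that this is Jensen's
inequality for the exponential; it follows from [1 + z < expR z]. *)
Lemma log_cosh_ratio_gt t x : t != 0 -> t * tanh x < log_cosh_ratio t x.
Proof.
move=> t0; rewrite -ltr_expR expR_log_cosh_ratio.
have x0 := expR_gt0 x; have nx0 := expR_gt0 (- x).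
have c0 := two_cosh_gt0 x; set c := expR x + expR (- x) in c0 *.
pose q := expR x / c; pose r := expR (- x) / c.
have qr : q + r = 1 by rewrite -mulrDl divff// gt_eqF.
have rE : r = 1 - q by rewrite -qr addrAC subrr add0r.
have q0 : 0 < q by rewrite divr_gt0.
have r0 : 0 < r by rewrite divr_gt0.
have -> : tanh x = q - r by rewrite /tanh -/c mulrBl.
rewrite opprD !expRD mulrDl ![_ * expR _ / c]mulrAC -/q -/r.
rewrite -[ltLHS]mul1r -ltr_pdivlMr ?expR_gt0// -expRN mulrDl.
rewrite -[q * _ * _]mulrA -[r * _ * _]mulrA -!expRD.
have -> : t - t * (q - r) = 2 * t * r.
  by rewrite rE; ring.
have -> : - t - t * (q - r) = - (2 * t * q).
  by rewrite rE; ring.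
have tq z : 0 < z -> 2 * t * z != 0.
  by move=> z0; rewrite mulf_neq0 ?(gt_eqF z0)// mulf_neq0 ?pnatr_eq0.
have e1 : 1 + 2 * t * r < expR (2 * t * r).
  by apply: expR_gt1Dx; exact: tq.
have e2 : 1 + - (2 * t * q) < expR (- (2 * t * q)).
  by apply: expR_gt1Dx; rewrite oppr_eq0 tq.
have h1 : q * (1 + 2 * t * r) < q * expR (2 * t * r) by rewrite ltr_pM2l.
have h2 : r * (1 + - (2 * t * q)) < r * expR (- (2 * t * q)).
  by rewrite ltr_pM2l.
by lra.
Qed.

Lemma bounded_measurable_log_cosh_ratio t :
  @bounded_measurable _ (measurableTypeR R) R (log_cosh_ratio t).
Proof.
split; last by exists `|t| => x; exact: log_cosh_ratio_norm.
have me b : measurable_fun [set: measurableTypeR R]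
    (fun x : R => expR (x + b) + expR (- (x + b))).
  apply: measurable_funD; apply: measurableT_comp => //.
    exact: measurable_funD.
  by apply: measurable_funN; exact: measurable_funD.
rewrite [X in measurable_fun _ X](_ : _ = fun x : R =>
    ln (expR (x + t) + expR (- (x + t)))
    - ln (expR (x + 0) + expR (- (x + 0)))).
  by apply: measurable_funB; apply: measurableT_comp => //; exact: measurable_ln.
apply/funext => x; rewrite addr0 /log_cosh_ratio ln_div// posrE;
  exact: two_cosh_gt0.
Qed.

(** Nonnegativity of the relative entropy of the two Gibbs measures: average
[1 + z <= expR z] at [z = B - (H - H0)] under the Gibbs measure of [H]. *)
Lemma gibbs_variational n (H H0 : config n -> R) (B : R) :
  partition_function H0 * expR B <= partition_function H ->
  B <= \sum_s gibbs H s * (H s - H0 s).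
Proof.
move=> ZB; have Z0 := partition_function_gt0 H.
have : \sum_s gibbs H s * (1 + (B - (H s - H0 s))) <= 1.
  apply: (@le_trans _ _ (\sum_s gibbs H s * expR (B - (H s - H0 s)))).
    by apply: ler_sum => s _; rewrite ler_wpM2l ?gibbs_ge0// expR_ge1Dx.
  rewrite gibbs_mean ler_pdivrMr// mul1r (le_trans _ ZB)// mulr_suml.
  apply: ler_sum => s _; rewrite -!expRD.
  by rewrite (_ : _ + (B - _) = H0 s + B)//; ring.
under eq_bigr do rewrite mulrDr mulrBr mulr1.
by rewrite big_split sumrB /= gibbs_sum1 -mulr_suml gibbs_sum1 mul1r; lra.
Qed.

Lemma partition_function_field n (y : 'I_n -> R) :
  partition_function (fun s => \sum_(i < n) y i * spin R (s i)) =
  \prod_(i < n) (expR (y i) + expR (- y i)).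
Proof.
rewrite /partition_function.
transitivity (\prod_(i < n) \sum_(b : bool) expR (y i * spin R b)).
  rewrite bigA_distr_bigA; apply: eq_bigr => s _.
  by rewrite expR_sum.
by apply: eq_bigr => i _; rewrite big_bool /= mulr1 mulrN1.
Qed.

(** A uniform extra field [t] on [S] keeps the spins independent. *)
Lemma partition_function_tilt n (h : n.-tuple R) (S : {set 'I_n}) t :
  partition_function
    (fun s => field_energy h s + t * \sum_(i in S) spin R (s i)) =
  partition_function (@field_energy R n h)
  * expR (\sum_(i in S) log_cosh_ratio t (tnth h i)).
Proof.
rewrite partition_function_field expR_sum [X in _ * X]big_mkcond -big_split /=.
rewrite -[LHS]/(\sum_s _).
transitivity (partition_function (fun s : config n =>
    \sum_(i < n) (tnth h i + (if i \in S then t else 0)) * spin R (s i))).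
  congr partition_function; apply/funext => s.
  rewrite mulr_sumr [X in _ + X]big_mkcond -big_split /=.
  by apply: eq_bigr => i _; case: ifP; rewrite ?addr0// mulrDl.
rewrite partition_function_field; apply: eq_bigr => i _; case: ifP => _.
  by rewrite expR_log_cosh_ratio mulrC divfK// gt_eqF// two_cosh_gt0.
by rewrite addr0 mulr1.
Qed.

Lemma planted_energyE n (theta1 : R) (S : {set 'I_n}) h s :
  planted_energy theta1 S h s =
  theta1 / (2 * #|S|%:R) * (\sum_(i in S) spin R (s i)) ^+ 2
  + field_energy h s.
Proof. by rewrite /planted_energy expr2 big_distrlr. Qed.

(** The Gibbs variational inequality, the quadratic interaction being bounded
below by its tangent [theta1 * a * (M - k * a / 2)] at [M = k * a]. *)
Lemma planted_mean_sqr_ge n (theta1 : R) (S : {set 'I_n}) h (a : R) :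
  0 < theta1 -> (0 < #|S|)%N ->
  \sum_(i in S) log_cosh_ratio (theta1 * a) (tnth h i)
    - theta1 * #|S|%:R * a ^+ 2 / 2 <=
  theta1 / (2 * #|S|%:R) * \sum_s gibbs (planted_energy theta1 S h) s
     * (\sum_(i in S) spin R (s i)) ^+ 2.
Proof.
move=> th0 S0; have S0R : 0 < #|S|%:R :> R by rewrite ltr0n.
rewrite mulr_sumr; under [leRHS]eq_bigr do rewrite mulrCA.
have -> : \sum_s gibbs (planted_energy theta1 S h) s *
    (theta1 / (2 * #|S|%:R) * (\sum_(i in S) spin R (s i)) ^+ 2) =
    \sum_s gibbs (planted_energy theta1 S h) s *
      (planted_energy theta1 S h s - field_energy h s).
  by apply: eq_bigr => s _; rewrite planted_energyE addrK.
apply: gibbs_variational; rewrite expRD mulrA -partition_function_tilt.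
rewrite mulr_suml; apply: ler_sum => s _; rewrite -expRD ler_expR.
rewrite planted_energyE addrAC [leRHS]addrC -addrA lerD2l.
set M := \sum_(i in S) _.
rewrite -subr_ge0 (_ : _ - _ =
    theta1 / (2 * #|S|%:R) * (M - #|S|%:R * a) ^+ 2).
  by rewrite mulr_ge0 ?sqr_ge0// divr_ge0 ?mulr_ge0// ltW.
by field; rewrite gt_eqF.
Qed.

Context (mu : probability (measurableTypeR R) R) (theta1 : R).
Context (th0 : 0 < theta1) (mean0 : mean_tanh mu != 0).

Let a := mean_tanh mu.
Let ell := \int[mu]_x log_cosh_ratio (theta1 * a) x.

Lemma mean_log_cosh_ratio_gt : theta1 * a ^+ 2 < ell.
Proof.
have bt := bounded_measurable_tanh R.
have bl := bounded_measurable_log_cosh_ratio (theta1 * a).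
have bc := bounded_measurable_cst (measurableTypeR R) (- (theta1 * a)).
have : 0 < \int[mu]_x
    (log_cosh_ratio (theta1 * a) x + - (theta1 * a) * tanh x).
  apply: Rintegral_gt0.
    by apply: bounded_measurableD => //; exact: bounded_measurableM.
  move=> x; rewrite mulNr subr_gt0 log_cosh_ratio_gt// mulf_neq0// gt_eqF//.
rewrite RintegralD//; last 2 first.
- exact: bounded_measurable_integrable.
- by apply: bounded_measurable_integrable; exact: bounded_measurableM.
rewrite RintegralZl//; last exact: bounded_measurable_integrable.
by rewrite -/(mean_tanh mu) -/a -/ell; lra.
Qed.

Lemma planted_second_moment_ge n (S : {set 'I_n}) : (0 < #|S|)%N ->
  #|S|%:R ^+ 2 * (2 * ell / theta1 - a ^+ 2) <=
  \sum_s PS mu theta1 S s * (\sum_(i in S) spin R (s i)) ^+ 2.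
Proof.
move=> S0; have S0R : 0 < #|S|%:R :> R by rewrite ltr0n.
have bl (i : 'I_n) : @bounded_measurable _ (n.-tuple (measurableTypeR R)) R
    (fun h => log_cosh_ratio (theta1 * a) (tnth h i)).
  have [ml [M lM]] := bounded_measurable_log_cosh_ratio (theta1 * a).
  split; last by exists M.
  by apply: measurableT_comp => //; exact: measurable_tnth.
have c0 : 0 < theta1 / (2 * #|S|%:R) by rewrite divr_gt0// mulr_gt0.
rewrite -(ler_pM2l c0) PS_mean -[leRHS]RintegralZl//; last first.
  by apply: bounded_measurable_integrable; exact: bounded_measurable_gibbs_mean.
have bsum : @bounded_measurable _ (n.-tuple (measurableTypeR R)) R
    (fun h => \sum_(i in S) log_cosh_ratio (theta1 * a) (tnth h i)).
  exact: bounded_measurable_sum.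
have bcst c : @bounded_measurable _ (n.-tuple (measurableTypeR R)) R (fun=> c).
  exact: bounded_measurable_cst.
have <- : \int[iid_law mu n]_h
    (\sum_(i in S) log_cosh_ratio (theta1 * a) (tnth h i)
      + - (theta1 * #|S|%:R * a ^+ 2 / 2)) =
    theta1 / (2 * #|S|%:R) * (#|S|%:R ^+ 2 * (2 * ell / theta1 - a ^+ 2)).
  rewrite RintegralD//; last 2 first.
  - exact: bounded_measurable_integrable.
  - exact: bounded_measurable_integrable.
  rewrite Rintegral_probability_cst Rintegral_sum_bounded//.
  have bL := bounded_measurable_log_cosh_ratio (theta1 * a).
  under eq_bigr do rewrite (iid_integral1 _ _ bL).
  rewrite sumr_const -/ell -mulr_natr.
  by field; rewrite !gt_eqF.
apply: le_Rintegral => //.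
- by apply: bounded_measurable_integrable; exact: bounded_measurableD.
- apply: bounded_measurable_integrable; apply: bounded_measurableM => //.
  exact: bounded_measurable_gibbs_mean.
- by move=> h _; exact: planted_mean_sqr_ge.
Qed.

(* half of the amount by which the lower bound on the second moment of M / k
   exceeds a ^+ 2 *)
Let b := ell / theta1 - a ^+ 2.

(** The second moment of [M / k] is at least [a ^+ 2 + 2 * b], which keeps [M / k]
away from [a] in mean square. *)
Lemma planted_deviation_ge : exists c : R, 0 < c /\
  forall n (S : {set 'I_n}), (0 < #|S|)%N ->
  c * #|S|%:R ^+ 2 <=
  \sum_s PS mu theta1 S s * (\sum_(i in S) (spin R (s i) - a)) ^+ 2.
Proof.
have b0 : 0 < b by rewrite subr_gt0 ltr_pdivlMr// mulrC mean_log_cosh_ratio_gt.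
pose D := a ^+ 2 + b.
have D0 : 0 < D by rewrite ltr_wpDl ?sqr_ge0.
exists (b ^+ 2 / D); split; first by rewrite divr_gt0 ?exprn_gt0.
move=> n S S0.
have := planted_second_moment_ge S0.
rewrite (_ : 2 * ell / theta1 - a ^+ 2 = D + b); last by rewrite /D /b; ring.
set k := #|S|%:R => m2.
(* pointwise, (M - k a) ^+ 2 is at least b / D * (M ^+ 2 - k ^+ 2 * D): the
   difference is (a M - D k) ^+ 2 / D *)
apply: (@le_trans _ _ (\sum_s PS mu theta1 S s *
    (b / D * ((\sum_(i in S) spin R (s i)) ^+ 2 - k ^+ 2 * D)))).
  under eq_bigr do rewrite mulrCA mulrBr.
  rewrite -mulr_sumr sumrB -mulr_suml PS_sum1 mul1r.
  rewrite (_ : b ^+ 2 / D * k ^+ 2 = b / D * (k ^+ 2 * b)); last by ring.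
  rewrite ler_wpM2l//; first by rewrite divr_ge0// ltW.
  by rewrite lerBrDr -mulrDr addrC.
apply: ler_sum => s _; apply: ler_wpM2l; first exact: PS_ge0.
rewrite sumrB sumr_const -mulr_natl -/k; set M := \sum_(i in S) _.
rewrite -subr_ge0 (_ : _ - _ = (a * M - D * k) ^+ 2 / D).
  by rewrite divr_ge0 ?sqr_ge0// ltW.
have aD : a ^+ 2 = D - b by rewrite /D addrK.
have -> : (a * M - D * k) ^+ 2 =
    (D - b) * M ^+ 2 - 2 * a * M * D * k + D ^+ 2 * k ^+ 2.
  by rewrite -aD; ring.
have -> : (M - k * a) ^+ 2 = M ^+ 2 - 2 * M * k * a + k ^+ 2 * (D - b).
  by rewrite -aD; ring.
by field; rewrite gt_eqF.
Qed.

End magnetization_gap.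

(** * Error probabilities of the test *)

Section test_errors.
Context (R : realType) (mu : probability (measurableTypeR R) R) (theta1 : R).
Let a := mean_tanh mu.

Lemma mean_tanh_le1 : `|a| <= 1.
Proof.
have [mt _] := bounded_measurable_tanh R.
by apply: normr_Rintegral_le => // x; rewrite ltW// tanh_lt1.
Qed.

Definition excess n (s : config n) : R :=
  (\sum_(i < n) spin R (s i) - n%:R * a) ^+ 2 - n%:R * (1 - a ^+ 2).

Lemma variance_bounds : 0 <= 1 - a ^+ 2 <= 1.
Proof.
have := mean_tanh_le1; rewrite ler_norml => /andP[? ?].
by apply/andP; split; nra.
Qed.

Lemma mean_excess n (S : {set 'I_n}) :
  \sum_s PS mu theta1 S s * excess s =
  \sum_s PS mu theta1 S s * (\sum_(i in S) (spin R (s i) - a)) ^+ 2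
  - #|S|%:R * (1 - a ^+ 2).
Proof.
under eq_bigr do rewrite mulrBr.
rewrite sumrB -mulr_suml PS_sum1 mul1r (@mean_sqr_magnetization _ _ _ S)//.
- by ring.
- exact: PS_sum1.
- by move=> i G; exact: PS_spin_outside.
Qed.

(** The square of a difference of two nonnegative numbers is at most the sum of
their squares, so that the fourth moment of [X] suffices. *)
Lemma mean_sqr_excess_le n (S : {set 'I_n}) :
  \sum_s PS mu theta1 S s * excess s ^+ 2 <=
  128 * #|S|%:R ^+ 4 + 385 * n%:R ^+ 2.
Proof.
have /andP[v0 v1] := variance_bounds.
apply: (@le_trans _ _ (\sum_s PS mu theta1 S s *
    ((\sum_(i < n) spin R (s i) - n%:R * a) ^+ 4 + n%:R ^+ 2))).
  apply: ler_sum => s _; apply: ler_wpM2l; first exact: PS_ge0.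
  rewrite /excess; set X := \sum_(i < n) _ - _; set v := 1 - _ in v0 v1 *.
  have n0 : 0 <= n%:R :> R by [].
  have X0 := sqr_ge0 X.
  have nv : (n%:R * v) ^+ 2 <= n%:R ^+ 2.
    by apply: lerXn2r; rewrite ?nnegrE ?mulr_ge0// ler_piMr.
  have Xnv : 0 <= X ^+ 2 * (n%:R * v) by apply: mulr_ge0 => //; exact: mulr_ge0.
  rewrite (_ : X ^+ 4 = (X ^+ 2) ^+ 2); last by rewrite -exprM.
  by rewrite sqrrB; lra.
under eq_bigr do rewrite mulrDr.
rewrite big_split /= -mulr_suml PS_sum1 mul1r.
have := @mean_pow4_magnetization _ _ (PS mu theta1 S) S a.
move=> /(_ (PS_ge0 _ _ _) (PS_sum1 _ _ _) mean_tanh_le1) h.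
have {}h := h (fun i G => @PS_spin_outside _ mu theta1 n S i G).
by lra.
Qed.

Lemma phi9_ge k m n (x : samples m n) (tau : R) : (0 < k)%N -> (0 < m)%N ->
  (tau <= phi9 mu k x) = (m%:R * (k%:R ^+ 2 * tau) <= \sum_(j < m) excess (x j)).
Proof.
move=> k0 m0; have m0R : 0 < m%:R :> R by rewrite ltr0n.
have k0R : 0 < k%:R :> R by rewrite ltr0n.
rewrite /phi9 -invfM mulrC ler_pdivlMr ?mulr_gt0 ?exprn_gt0//.
by rewrite mulrC mulrA.
Qed.

Lemma null_error_le (k m n : nat) (C tau : R) : (0 < k)%N -> (0 < m)%N ->
  n%:R <= C * k%:R ^+ 2 -> 0 < tau ->
  prod_prob (@P0 R mu n) (fun x : samples m n => tau <= phi9 mu k x) <=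
  (128 + 385 * C ^+ 2) / tau ^+ 2 / m%:R.
Proof.
move=> k0 m0 nC tau0; have m0R : 0 < m%:R :> R by rewrite ltr0n.
have k0R : 0 < k%:R ^+ 2 :> R by rewrite exprn_gt0// ltr0n.
have [S cS PSE] : exists2 S : {set 'I_n},
    #|S| = 0%N & @P0 R mu n = PS mu theta1 S.
  by exists finset.set0; [exact: cards0|exact: P0_PS].
have Ef0 : \sum_s PS mu theta1 S s * excess s = 0.
  rewrite mean_excess cS mul0r subr0 big1// => s _.
  by rewrite (cards0_eq cS) big_set0 expr0n mulr0.
rewrite PSE.
have kt0 : 0 < k%:R ^+ 2 * tau by rewrite mulr_gt0.
apply: le_trans
  (prod_prob_chebyshev (PS_ge0 _ _ _) (PS_sum1 _ _ _) Ef0 m0 kt0 _) _.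
  by move=> x; rewrite phi9_ge// => /le_trans -> //; exact: ler_norm.
have := mean_sqr_excess_le S; rewrite cS expr0n mulr0 add0r => E2.
have mkt0 := mulr_gt0 m0R (exprn_gt0 2 kt0).
rewrite ler_pdivrMr//; apply: le_trans E2 _.
rewrite [leRHS](_ : _ =
    128 * (k%:R ^+ 2) ^+ 2 + 385 * (C * k%:R ^+ 2) ^+ 2); last first.
  by field; rewrite !gt_eqF.
apply: ler_wpDl; first by rewrite mulr_ge0 ?ler0n ?sqr_ge0.
rewrite ler_pM2l ?ltr0n//.
by rewrite lerXn2r ?nnegrE// (le_trans _ nC).
Qed.

(** Once [k >= 2 / c], the variance term [k * (1 - a ^+ 2)] is at most half of
[c * k ^+ 2], so that the mean excess is at least [c / 2 * k ^+ 2].  Accepting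
the null means an average excess below [c / 4 * k ^+ 2], a deviation by at least
as much from the mean. *)
Lemma planted_error_le (k m n : nat) (S : {set 'I_n}) (C c tau : R) :
  (0 < k)%N -> (0 < m)%N -> #|S| = k ->
  n%:R <= C * k%:R ^+ 2 -> 0 < c -> tau <= c / 4 -> 2 / c <= k%:R ->
  c * k%:R ^+ 2 <=
    \sum_s PS mu theta1 S s * (\sum_(i in S) (spin R (s i) - a)) ^+ 2 ->
  prod_prob (PS mu theta1 S) (predC (fun x : samples m n => tau <= phi9 mu k x))
  <= (128 + 385 * C ^+ 2) / (c / 4) ^+ 2 / m%:R.
Proof.
move=> k0 m0 Sk nC c0 tauc ck cS; have m0R : 0 < m%:R :> R by rewrite ltr0n.
have k0R : 0 < k%:R :> R by rewrite ltr0n.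
have k2R : 0 < k%:R ^+ 2 :> R by rewrite exprn_gt0.
pose e := \sum_s PS mu theta1 S s * excess s.
have eE : c / 2 * k%:R ^+ 2 <= e.
  rewrite /e mean_excess Sk.
  have /andP[v0 v1] := variance_bounds.
  have : k%:R * (1 - a ^+ 2) <= k%:R :> R by rewrite ler_piMr.
  have : k%:R <= c / 2 * k%:R ^+ 2.
    rewrite expr2 mulrA ler_peMl//.
    by move: ck; rewrite ler_pdivrMr//; lra.
  by move: cS; lra.
have Eg0 : \sum_s PS mu theta1 S s * (excess s - e) = 0.
  under eq_bigr do rewrite mulrBr.
  by rewrite sumrB -mulr_suml PS_sum1 mul1r subrr.
have Eg2 : \sum_s PS mu theta1 S s * (excess s - e) ^+ 2 <=
    \sum_s PS mu theta1 S s * excess s ^+ 2.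
  have -> : \sum_s PS mu theta1 S s * (excess s - e) ^+ 2 =
      \sum_s PS mu theta1 S s * excess s ^+ 2 - e ^+ 2.
    under eq_bigr => s _.
      rewrite (_ : _ * _ = PS mu theta1 S s * excess s ^+ 2
        - 2 * e * (PS mu theta1 S s * excess s) + PS mu theta1 S s * e ^+ 2).
        over.
      by ring.
    rewrite big_split sumrB /= -mulr_suml PS_sum1 mul1r -mulr_sumr -/e.
    by ring.
  by rewrite lerBlDr lerDl sqr_ge0.
have kt0 : 0 < k%:R ^+ 2 * (c / 4) by rewrite mulr_gt0// divr_gt0.
apply: le_trans
  (prod_prob_chebyshev (PS_ge0 _ _ _) (PS_sum1 _ _ _) Eg0 m0 kt0 _) _.
  move=> x; rewrite /= phi9_ge// -ltNge => fx.
  rewrite sumrB sumr_const card_ord -mulr_natl -normrN.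
  apply: le_trans (ler_norm _).
  have : m%:R * (k%:R ^+ 2 * tau) <= m%:R * (k%:R ^+ 2 * (c / 4)).
    by rewrite !ler_pM2l.
  have : m%:R * (c / 2 * k%:R ^+ 2) <= m%:R * e by rewrite ler_pM2l.
  by move: fx; nra.
have := mean_sqr_excess_le S; rewrite Sk => E2.
have mkt0 := mulr_gt0 m0R (exprn_gt0 2 kt0).
rewrite ler_pdivrMr//; apply: le_trans Eg2 _; apply: le_trans E2 _.
rewrite [leRHS](_ : _ = 128 * k%:R ^+ 4 + 385 * (C * k%:R ^+ 2) ^+ 2); last first.
  by field; rewrite !gt_eqF.
rewrite lerD2l ler_pM2l ?ltr0n//.
by rewrite lerXn2r ?nnegrE// (le_trans _ nC).
Qed.

End test_errors.

Theorem theorem4p3 (R : realType) (mu : probability (measurableTypeR R) R)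
    (theta1 : R) (theta1_gt0 : 0 < theta1) (mean_neq0 : mean_tanh mu <> 0) :
  exists tau0 : R, 0 < tau0 /\
    forall tau : R, 0 < tau -> tau <= tau0 ->
    forall n m : nat -> nat,
      (forall k, (k <= n k)%N) ->
      (forall k, (1 <= m k)%N) ->
      (fun k => Num.sqrt ((n k)%:R : R)) =O_\oo (fun k => k%:R : R) ->
      (fun=> 1 : R) =o_\oo (fun k => (m k)%:R : R) ->
      asymptotically_powerful mu theta1
        (fun k (x : samples (m k) (n k)) => tau <= phi9 mu k x).
Proof.
have /eqP mean0 := mean_neq0.
have [c [c0 cS]] := planted_deviation_ge theta1_gt0 mean0.
exists (c / 4); split; first by rewrite divr_gt0.
move=> tau tau0 tauc n m kn m1 /eqOP nO /eqoP mo.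
have [C [C0 nC]] : exists C : R, 0 < C /\
    \forall k \near \oo, (n k)%:R <= C * (k%:R : R) ^+ 2.
  have [M [Mreal nM]] := nO.
  pose B := Num.max (M + 1) 1.
  have B0 : 0 < B by rewrite lt_max ltr01 orbT.
  exists (B ^+ 2); split; first by rewrite exprn_gt0.
  have MB : M < B by rewrite lt_max ltrDl ltr01.
  have := nM _ MB; apply: filterS => k.
  rewrite ger0_norm ?sqrtr_ge0// ger0_norm// => nk.
  rewrite -[leLHS]sqr_sqrtr// -exprMn lerXn2r ?nnegrE ?sqrtr_ge0//.
  by rewrite mulr_ge0// ltW.
(* the common numerator of the error bounds; leaving it abstract avoids the
   unfolding of its numerals *)
have [N N0 NE] : exists2 N : R, 0 < N & 128 + 385 * C ^+ 2 = N.
  exists (128 + 385 * C ^+ 2); last by [].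
  by apply: ltr_wpDr; [rewrite mulr_ge0 ?ler0n ?sqr_ge0|rewrite ltr0n].
pose K := N / tau ^+ 2 + N / (c / 4) ^+ 2.
have K0 : 0 < K by rewrite addr_gt0 ?divr_gt0 ?exprn_gt0 ?divr_gt0.
apply/cvgrPdist_le => eps eps0; near=> k.
have k0 : (0 < k)%N by near: k; exact: nbhs_infty_gt.
have nk : (n k)%:R <= C * (k%:R : R) ^+ 2 by near: k.
have ck : 2 / c <= k%:R by near: k; exact: nbhs_infty_ger.
have mk : K / (m k)%:R <= eps.
  have m0 : 0 < (m k)%:R :> R by rewrite ltr0n.
  have : `|1 : R| <= eps / K * `|(m k)%:R : R|.
    by near: k; apply: mo; rewrite divr_gt0.
  rewrite normr1 ger0_norm// ler_pdivrMr// mulrAC ler_pdivlMr// mul1r.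
  by [].
have alt_le (S : {set 'I_(n k)}) : #|S| = k ->
    prod_prob (PS mu theta1 S)
      (predC (fun x : samples (m k) (n k) => tau <= phi9 mu k x)) <=
    N / (c / 4) ^+ 2 / (m k)%:R.
  move=> Sk; rewrite -NE; apply: planted_error_le => //.
  by rewrite -{1}Sk; apply: cS; rewrite Sk.
set A := [set _ | _ in _].
have A_le : sup A <= N / (c / 4) ^+ 2 / (m k)%:R.
  have [A0|/set0P/negP/negPn/eqP ->] := pselect (A !=set0).
    by apply: ge_sup => // _ [S /= Sk <-]; exact: alt_le.
  by rewrite sup0 !divr_ge0 ?sqr_ge0 ?ler0n ?(ltW N0).
have A_ge : 0 <= sup A.
  have [[y Ay]|/set0P/negP/negPn/eqP ->] := pselect (A !=set0); last first.
    by rewrite sup0.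
  have y0 : 0 <= y.
    by case: Ay => S _ <-; apply: prod_prob_ge0 => s; exact: PS_ge0.
  rewrite (le_trans y0)//; apply: ub_le_sup => //.
  exists (N / (c / 4) ^+ 2 / (m k)%:R).
  by move=> _ [S /= Sk <-]; exact: alt_le.
rewrite sub0r normrN ger0_norm; last first.
  rewrite addr_ge0// (P0_PS mu theta1); apply: prod_prob_ge0 => s.
  exact: PS_ge0.
rewrite (le_trans _ mk)// /K mulrDl lerD//.
by rewrite -NE; exact: null_error_le.
Unshelve. all: by end_near.
Qed.
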